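(* For each $n$ let $\mathcal C_n$ be a collection of distributions $\mathbb P_n$ (as described in the context). Suppose that for every $C^3$ function $H:\mathbb R\to\mathbb R$ that is bounded with bounded derivatives up to third order, $$\lim_n\sup_{\mathbb P_n\in\mathcal C_n}\Big|\widetilde{\mathbb E}_{\mathbb P_n}\big[H\circ P^{(j)}(\mathcal Z_n;\sqrt n\beta_n)\big]-\widetilde{\mathbb E}_{\mathcal N}\big[H\circ P^{(j)}(\mathcal Z_n;\sqrt n\beta_n)\big]\Big|=0,$$ and that $$\lim_n\sup_{\mathbb P_n\in\mathcal C_n}\frac{\mathbb E_{\mathbb P_n}\big[|\bar F_n(\Sigma^{1/2}\mathcal Z_n+\sqrt n\beta_n)-F(\Sigma^{1/2}\mathcal Z_n+\sqrt n\beta_n)|\big]}{\mathbb E_{\mathbb P_n}\big[F(\Sigma^{1/2}\mathcal Z_n+\sqrt n\beta_n)\big]}=0 .$$ Then, for every such $H$, $$\lim_n\sup_{\mathbb P_n\in\mathcal C_n}\Big|\overline{\mathbb E}_{\mathbb P_n}\big[H\circ P^{(j)}(\mathcal Z_n;\sqrt n\beta_n)\big]-\widetilde{\mathbb E}_{\mathcal N}\big[H\circ P^{(j)}(\mathcal Z_n;\sqrt n\beta_n)\big]\Big|=0 .$$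
   Context: Fix $d\in\mathbb N$ and an invertible covariance matrix $\Sigma\in\mathbb R^{d\times d}$. For each $n$, $\zeta_{1,n},\dots,\zeta_{n,n}$ are i.i.d. $\mathbb R^d$-valued with law $\mathbb P_n$, mean $\beta_n$ and covariance $\Sigma$; $V_n=n^{-1/2}\sum_i\zeta_{i,n}$ has a Lebesgue density, and $\mathcal Z_n=\Sigma^{-1/2}(V_n-\sqrt n\beta_n)$. $\mathbb E_{\mathbb P_n}$ is expectation under $\mathbb P_n$; $\mathbb E_{\mathcal N}$ is expectation when $\mathcal Z_n\sim\mathcal N(0_d,I_{d,d})$. Carving: a random subsample of size $n_1<n$ is the pilot data; $n_2=n-n_1$, $\rho^2=n_2/n_1$ (fixed), $V_{n_1}=\sqrt{n_1}\,\bar\zeta_{n_1}$ where $\bar\zeta_{n_1}$ is the pilot sample mean. Index $k$ is selected if $V_{n_1}^{(k)}>\tau^{(k)}$ for a fixed $\tau\in\mathbb R^d$. With $W_n=\sqrt{1+\rho^2}\,V_{n_1}-V_n$ and $\Lambda_{\rm sel}=\sqrt{1+\rho^2}\,\tau$, this is the rule $V_n^{(k)}+W_n^{(k)}>\Lambda_{\rm sel}^{(k)}$. The observed selected set $E_{\rm obs}\ne\emptyset$ has $p$ elements; components are ordered so that $E_{\rm obs}=[p]$; $A_{\rm obs}\in\mathbb R^{d-p}$ is the fixed observed value of $A_n=V_n^{(E_n^c)}+W_n^{(E_n^c)}$, where $E_n$ is the selected set. Fix $j\in E_{\rm obs}$. Let $$Q=\begin{bmatrix}I_{p,p}\\0_{d-p,p}\end{bmatrix},\quad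 r=\begin{pmatrix}\Lambda_{\mathrm{sel}}^{(E_{\rm obs})}\\ A_{\rm obs}\end{pmatrix},\quad F(x)=\int_{(0,\infty)^p}\exp\Big(-\tfrac1{2\rho^2}(Qt-x+r)'\Sigma^{-1}(Qt-x+r)\Big)dt .$$ The pair $(V_n,W_n)$ is taken to have joint density $\mathrm p_n(v)\bar{\mathrm p}_n(w\mid v)$, with $\mathrm p_n$ the marginal density of $V_n$ and $\bar{\mathrm p}_n(\cdot\mid v)$ the conditional density of $W_n$ given $V_n=v$, and $$\bar F_n(v)=\int_{(0,\infty)^p}\bar{\mathrm p}_n(Qt-v+r\mid v)\,dt .$$ Write $\sigma_j^2=\Sigma_{jj}$, $\Sigma_{-j,j}$ for the $j$-th column of $\Sigma$ without its $j$-th entry, $x^{(-j)}$ for $x$ without component $j$. $R^{(j)}$ is the invertible matrix mapping $(v,u')'$ ($v\in\mathbb R,u\in\mathbb R^{d-1}$) to $x$ with $x^{(j)}=v$, $x^{(-j)}=u+\sigma_j^{-2}\Sigma_{-j,j}v$. With $\phi$ the standard normal density, the pivot is $$P^{(j)}(z;\sqrt n\beta_n)=\frac{\int_{v_0}^\infty\phi\big((v-\sqrt n\beta_n^{(j)})/\sigma_j\big)F(R^{(j)}(v,u_0')')\,dv}{\int_{-\infty}^\infty\phi\big((v-\sqrt n\beta_n^{(j)})/\sigma_j\big)F(R^{(j)}(v,u_0')')\,dv},\qquad (v_0,u_0')'=(R^{(j)})^{-1}(\Sigma^{1/2}z+\sqrt n\beta_n).$$ Conditional expectations: $$\widetilde{\mathbb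 E}_{\mathbb P_n}[\mathcal Q(\mathcal Z_n)]=\frac{\mathbb E_{\mathbb P_n}[\mathcal Q(\mathcal Z_n)F(\Sigma^{1/2}\mathcal Z_n+\sqrt n\beta_n)]}{\mathbb E_{\mathbb P_n}[F(\Sigma^{1/2}\mathcal Z_n+\sqrt n\beta_n)]},\qquad \overline{\mathbb E}_{\mathbb P_n}[\mathcal Q(\mathcal Z_n)]=\frac{\mathbb E_{\mathbb P_n}[\mathcal Q(\mathcal Z_n)\bar F_n(\Sigma^{1/2}\mathcal Z_n+\sqrt n\beta_n)]}{\mathbb E_{\mathbb P_n}[\bar F_n(\Sigma^{1/2}\mathcal Z_n+\sqrt n\beta_n)]},$$ and $\widetilde{\mathbb E}_{\mathcal N}$ is $\widetilde{\mathbb E}_{\mathbb P_n}$ with $\mathbb E_{\mathbb P_n}$ replaced by $\mathbb E_{\mathcal N}$. *)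

(* Defs.v *)
From HB Require Import structures.
From mathcomp Require Import all_boot all_order all_algebra.
From mathcomp Require Import all_classical all_reals all_analysis.

Set Implicit Arguments.
Unset Strict Implicit.
Unset Printing Implicit Defensive.

Import Order.TTheory GRing.Theory Num.Theory.
Import numFieldNormedType.Exports.

Local Open Scope classical_set_scope.
Local Open Scope ring_scope.

Definition measure_matrix_display : measure_display -> measure_display.
Proof. exact. Qed.

(* Matrices carry the sigma-algebra generated by their entries; over a realType
   this is the Borel sigma-algebra. *)
Section measurable_matrix.
Context {d : measure_display} {T : measurableType d} (m n : nat).

Definition matrix_measurable : set (set 'M[T]_(m, n)) :=
  <<s [set A | exists i j (B : set T),
         measurable B /\ A = (fun M : 'M[T]_(m, n) => M i j) @^-1` B] >>.

Let matrix_measurable0 : matrix_measurable set0.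
Proof. exact: sigma_algebra0. Qed.

Let matrix_measurableC A : matrix_measurable A -> matrix_measurable (~` A).
Proof. exact: sigma_algebraC. Qed.

Let matrix_measurable_bigcup (F : (set 'M[T]_(m, n))^nat) :
  (forall i, matrix_measurable (F i)) -> matrix_measurable (\bigcup_i (F i)).
Proof. exact: sigma_algebra_bigcup. Qed.

HB.instance Definition _ := @isMeasurable.Build (measure_matrix_display d)
  'M[T]_(m, n) matrix_measurable matrix_measurable0 matrix_measurableC
  matrix_measurable_bigcup.

End measurable_matrix.

Lemma measurable_entry d (T : measurableType d) m n (i : 'I_m) (j : 'I_n) :
  measurable_fun [set: 'M[T]_(m, n)] (fun M : 'M[T]_(m, n) => M i j).
Proof.
move=> _ B mB; rewrite setTI; apply: sub_sigma_algebra.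
by exists i, j, B.
Qed.

Lemma measurable_fun_matrixP d1 d2 (T1 : measurableType d1)
    (T2 : measurableType d2) m n (f : T1 -> 'M[T2]_(m, n)) :
  measurable_fun [set: T1] f <->
  forall i j, measurable_fun [set: T1] (fun x => f x i j).
Proof.
split=> [mf i j|mf].
  exact: (measurableT_comp (measurable_entry i j) mf).
apply: (@measurability _ _ _ _ _ _ [set A | exists i j (B : set T2),
  measurable B /\ A = (fun M : 'M[T2]_(m, n) => M i j) @^-1` B]) => //.
move=> _ [_ [i [j [B [mB ->]]]] <-].
exact: (mf i j measurableT B mB).
Qed.

(* A sigma-finite measure transported along a measurable map with a measurable
   left inverse is sigma-finite. *)
Lemma pushforward_sigma_finite d1 d2 (T1 : measurableType d1)
    (T2 : measurableType d2) (R : realType)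
    (m : {measure set T1 -> \bar R}) (f : T1 -> T2) (g : T2 -> T1) :
  sigma_finite setT m -> measurable_fun [set: T1] f -> measurable_fun [set: T2] g -> cancel f g ->
  sigma_finite setT (pushforward m f).
Proof.
move=> [F UF mF] mf mg fK.
exists (fun k => g @^-1` F k).
  apply/seteqP; split=> // y _.
  have : [set: T1] (g y) by [].
  by rewrite UF => -[k _ Fky]; exists k.
move=> k; have [mFk Fkoo] := mF k; split.
  by rewrite -[X in measurable X]setTI; exact: mg.
rewrite /pushforward (_ : f @^-1` _ = F k)//.
by apply/seteqP; split=> x /=; rewrite fK.
Qed.

Lemma product_measure1_sigma_finite d1 d2 (T1 : measurableType d1)
    (T2 : measurableType d2) (R : realType)
    (m1 : {sigma_finite_measure set T1 -> \bar R})
    (m2 : {sigma_finite_measure set T2 -> \bar R}) :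
  sigma_finite setT (m1 \x m2)%E.
Proof.
have /sigma_finiteP[F [TF ndF Foo]] := sigma_finiteT m1.
have /sigma_finiteP[G [TG ndG Goo]] := sigma_finiteT m2.
exists (fun n => F n `*` G n).
  rewrite -setXTT TF TG predeqE => -[x y]; split.
    move=> [/= [n _ Fnx] [k _ Gky]]; exists (maxn n k) => //; split.
    - by move: x Fnx; exact/subsetPset/ndF/leq_maxl.
    - by move: y Gky; exact/subsetPset/ndG/leq_maxr.
  by move=> [n _ []/= ? ?]; split; exists n.
move=> k; have [? ?] := Foo k; have [? ?] := Goo k.
split; first exact: measurableX.
by rewrite product_measure1E// lte_mul_pinfty// ge0_fin_numE.
Qed.

Section product_power.
Context d (T : measurableType d) (R : realType).

Definition cons_pair n (x : T * n.-tuple T) : n.+1.-tuple T :=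
  [tuple of x.1 :: x.2].

Definition uncons_pair n (t : n.+1.-tuple T) : T * n.-tuple T :=
  (thead t, [tuple of behead t]).

Lemma cons_pairK n : cancel (@cons_pair n) (@uncons_pair n).
Proof.
move=> [x t]; rewrite /uncons_pair /cons_pair /= theadE.
by congr (_, _); apply: val_inj.
Qed.

Lemma measurable_cons_pair n : measurable_fun setT (@cons_pair n).
Proof. exact: measurable_cons. Qed.

Lemma measurable_uncons_pair n : measurable_fun setT (@uncons_pair n).
Proof.
apply/measurable_fun_pairP; split; first exact: measurable_tnth.
exact: measurable_behead.
Qed.

Section cons_measure.
Variables (n : nat) (m1 : {sigma_finite_measure set T -> \bar R})
  (m2 : {sigma_finite_measure set (n.-tuple T) -> \bar R}).

Definition cons_measure : set (n.+1.-tuple T) -> \bar R :=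
  pushforward (m1 \x m2)%E (@cons_pair n).

HB.instance Definition _ := Measure.copy cons_measure
  (measure_function_pushforward__canonical__measure_function_Measure
     (m1 \x m2)%E (@measurable_cons_pair n)).

Let cons_measure_sigma_finite : sigma_finite setT cons_measure.
Proof.
apply: (@pushforward_sigma_finite _ _ _ _ _ _ _ (@uncons_pair n)).
- exact: product_measure1_sigma_finite.
- exact: measurable_cons_pair.
- exact: measurable_uncons_pair.
- exact: cons_pairK.
Qed.

HB.instance Definition _ := Measure_isSigmaFinite.Build _ _ _ cons_measure
  cons_measure_sigma_finite.

End cons_measure.

(* The n-fold product measure mu \x ... \x mu. *)
Fixpoint product_power (mu : {sigma_finite_measure set T -> \bar R}) (n : nat) :
    {sigma_finite_measure set (n.-tuple T) -> \bar R} :=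
  match n return {sigma_finite_measure set (n.-tuple T) -> \bar R} with
  | 0 => \d_([tuple] : 0.-tuple T)
  | n'.+1 => cons_measure mu (product_power mu n')
  end.

Lemma product_power_box (mu : {sigma_finite_measure set T -> \bar R}) n
    (A : 'I_n -> set T) :
  (forall i, measurable (A i)) ->
  (product_power mu n [set t | forall i, A i (tnth t i)] =
   \prod_(i < n) mu (A i))%E.
Proof.
elim: n A => [|n IHn] A mA.
  rewrite big_ord0 /= diracE mem_set//.
  by move=> [].
rewrite big_ord_recl -IHn//= -product_measure1E//; last first.
  rewrite (_ : [set t | _] = \bigcap_(i in [set: 'I_n])
    ((fun t : n.-tuple T => tnth t i) @^-1` A (lift ord0 i))).
    apply: fin_bigcap_measurable => // i _.
    by rewrite -[X in measurable X]setTI; exact: measurable_tnth.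
  by apply/seteqP; split=> t /= h i; [move=> _; exact: h|exact: h].
congr ((_ \x _)%E _); apply/seteqP; split=> -[x t] /=.
  move=> h; split; first exact: (h ord0).
  by move=> i; have := h (lift ord0 i); rewrite tnthS.
move=> [/= Ax h] i; case: (unliftP ord0 i) => [j ->|->//].
by rewrite tnthS.
Qed.

End product_power.

Section column_measures.
Context (R : realType) (d : nat).

Definition col_of_tuple (t : d.-tuple (measurableTypeR R)) : 'cV[R]_d := \col_i tnth t i.

Definition tuple_of_col (x : 'cV[R]_d) : d.-tuple (measurableTypeR R) :=
  [tuple x i 0 | i < d].

Lemma col_of_tupleK : cancel col_of_tuple tuple_of_col.
Proof. by move=> t; apply: eq_from_tnth => i; rewrite tnth_mktuple mxE. Qed.

Lemma measurable_col_of_tuple : measurable_fun setT col_of_tuple.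
Proof.
apply/measurable_fun_matrixP => i j.
under eq_fun do rewrite mxE.
exact: measurable_tnth.
Qed.

Lemma measurable_tuple_of_col : measurable_fun setT tuple_of_col.
Proof.
apply/measurable_fun_tnthP => i; rewrite /comp /=.
under eq_fun do rewrite tnth_mktuple.
exact: measurable_entry.
Qed.

(* Product measure on R^d with all d marginals equal to mu. *)
Definition col_power (mu : {sigma_finite_measure set (measurableTypeR R) -> \bar R}) :
    set 'cV[R]_d -> \bar R :=
  pushforward (product_power mu d) col_of_tuple.

Section instances.
Variable mu : {sigma_finite_measure set (measurableTypeR R) -> \bar R}.

HB.instance Definition _ := Measure.copy (col_power mu)
  (measure_function_pushforward__canonical__measure_function_Measure
     (product_power mu d) measurable_col_of_tuple).

Let col_power_sigma_finite : sigma_finite setT (col_power mu).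
Proof.
apply: (pushforward_sigma_finite (g := tuple_of_col)).
- exact: sigma_finiteT.
- exact: measurable_col_of_tuple.
- exact: measurable_tuple_of_col.
- exact: col_of_tupleK.
Qed.

HB.instance Definition _ := Measure_isSigmaFinite.Build _ _ _ (col_power mu)
  col_power_sigma_finite.
End instances.
End column_measures.

Definition lebesgue_col (R : realType) (d : nat) :
    {sigma_finite_measure set 'cV[R]_d -> \bar R} :=
  @col_power R d (@lebesgue_measure R).

Definition std_normal_col (R : realType) (d : nat) :
    {sigma_finite_measure set 'cV[R]_d -> \bar R} :=
  @col_power R d (normal_prob (0 : R) 1).

Section matrices.
Context (R : realType).

Definition quad_form n (M : 'M[R]_n) (x : 'cV[R]_n) : R := (x^T *m M *m x) 0 0.

(* The covariance matrices are exactly these matrices. *)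
Definition sym_psd n (M : 'M[R]_n) : Prop :=
  M^T = M /\ forall x : 'cV[R]_n, 0 <= quad_form M x.

(* S is the (unique) symmetric positive semidefinite square root M^{1/2}. *)
Definition is_sqrt_mx n (M S : 'M[R]_n) : Prop := sym_psd S /\ S *m S = M.

(* The matrix R^(j), in the block coordinates (v, u) of R^(1 + d). *)
Definition slice_mx d (Sigma : 'M[R]_d.+1) (j : 'I_d.+1) : 'M[R]_(d.+1, 1 + d) :=
  row_mx (\col_i (if i == j then 1 else Sigma i j / Sigma j j))
         (\matrix_(i, k) (i == lift j k)%:R).

Lemma slice_mx_j d (Sigma : 'M[R]_d.+1) j (v : R) (u : 'cV[R]_d) :
  (slice_mx Sigma j *m col_mx v%:M u) j 0 = v.
Proof.
rewrite mul_row_col !mxE big_ord1 !mxE eqxx mul1r mulr1n big1 ?addr0// => k _.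
by rewrite !mxE (negbTE (neq_lift j k)) mul0r.
Qed.

Lemma slice_mx_lift d (Sigma : 'M[R]_d.+1) j (v : R) (u : 'cV[R]_d) k :
  (slice_mx Sigma j *m col_mx v%:M u) (lift j k) 0 =
  u k 0 + (Sigma j j)^-1 * Sigma (lift j k) j * v.
Proof.
rewrite mul_row_col !mxE big_ord1 !mxE [lift j k == j]eq_sym (negbTE (neq_lift j k)) mulr1n.
rewrite addrC (bigD1 k)//= !mxE eqxx mul1r big1 ?addr0; last first.
  by move=> l lk; rewrite !mxE (inj_eq (@lift_inj _ _)) eq_sym (negbTE lk) mul0r.
by rewrite [_ / _]mulrC.
Qed.

Lemma slice_mx_unit d (Sigma : 'M[R]_d.+1) j :
  (slice_mx Sigma j : 'M[R]_d.+1) \in unitmx.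
Proof.
rewrite -row_free_unit; apply/row_freeP.
pose B : 'M[R]_(1 + d, d.+1) :=
  col_mx (\row_k (k == j)%:R)
    (\matrix_(i, k) ((k == lift j i)%:R
                     - (Sigma j j)^-1 * Sigma (lift j i) j * (k == j)%:R)).
have BK : slice_mx Sigma j *m B = 1%:M.
  apply/matrixP => i k.
  have -> : (slice_mx Sigma j *m B) i k = (slice_mx Sigma j *m col k B) i 0.
    by rewrite !mxE; apply: eq_bigr => l _; rewrite !mxE.
  rewrite /B col_col_mx.
  rewrite (_ : col k (\row_l _) = ((k == j)%:R)%:M); last first.
    by apply/matrixP => a b; rewrite !ord1 !mxE mulr1n.
  case: (unliftP j i) => [l ->|->]; last by rewrite slice_mx_j mxE eq_sym.
  by rewrite slice_mx_lift !mxE subrK eq_sym.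
by exists B.
Qed.

End matrices.

Section carving.
Context (R : realType).

Definition V_stat d n (s : n.-tuple 'cV[R]_d) : 'cV[R]_d :=
  (Num.sqrt n%:R)^-1 *: \sum_(i < n) tnth s i.

(* V_{n_1}, for the pilot data with indices in I, #|I| = n_1 *)
Definition V_pilot d n (I : {set 'I_n}) (s : n.-tuple 'cV[R]_d) : 'cV[R]_d :=
  Num.sqrt (#|I|%:R) *: ((#|I|%:R)^-1 *: \sum_(i in I) tnth s i).

Definition W_stat d (rho2 : R) n (I : {set 'I_n}) (s : n.-tuple 'cV[R]_d) :
    'cV[R]_d :=
  Num.sqrt (1 + rho2) *: V_pilot I s - V_stat s.

(* Joint law of (V_n, W_n) when zeta_1, ..., zeta_n are i.i.d. with law P and
   the pilot subsample is drawn uniformly among the subsets of size n1,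
   independently of the data. *)
Definition VW_law d (rho2 : R) n n1 (P : probability 'cV[R]_d R)
    (B : set ('cV[R]_d * 'cV[R]_d)) : \bar R :=
  ((('C(n, n1)%:R)^-1)%:E *
   \sum_(I : {set 'I_n} | #|I| == n1)
     product_power P n [set s | B (V_stat s, W_stat rho2 I s)])%E.

Definition mean_vec d (P : probability 'cV[R]_d R) : 'cV[R]_d :=
  \col_k fine ('E_P[fun x : 'cV[R]_d => x k 0]).

(* P is a law of one observation for which the carving set-up holds at sample
   size n with pilot size n1; pV is the density of V_n and pW v the conditional
   density of W_n given V_n = v.  As rho2 is fixed, a sample size n that cannot
   be split in the ratio rho2 admits no such law. *)
Record carving_law d (Sigma : 'M[R]_d) (rho2 : R) (n n1 : nat)
    (P : probability 'cV[R]_d R)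
    (pV : 'cV[R]_d -> R) (pW : 'cV[R]_d -> 'cV[R]_d -> R) : Prop := {
  pilot_size : (0 < n1 < n)%N ;
  split_ratio : rho2 = (n - n1)%N%:R / n1%:R ;
  square_integrable : forall k, (fun x : 'cV[R]_d => x k 0) \in Lfun P 2%:E ;
  covariance_Sigma : forall k l,
    covariance P (fun x : 'cV[R]_d => x k 0) (fun x : 'cV[R]_d => x l 0)
    = (Sigma k l)%:E ;
  pV_measurable : measurable_fun [set: 'cV[R]_d] pV ;
  pV_ge0 : forall v, 0 <= pV v ;
  pV_density : forall B : set 'cV[R]_d, measurable B ->
    (product_power P n [set s | B (V_stat s)]
     = \int[lebesgue_col R d]_(v in B) (pV v)%:E)%E ;
  pW_measurable : measurable_fun [set: 'cV[R]_d * 'cV[R]_d]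
    (fun vw : 'cV[R]_d * 'cV[R]_d => pW vw.1 vw.2) ;
  pW_ge0 : forall v w, 0 <= pW v w ;
  pW_density : forall v, 0 < pV v ->
    (\int[lebesgue_col R d]_w (pW v w)%:E = 1)%E ;
  VW_density : forall B : set ('cV[R]_d * 'cV[R]_d), measurable B ->
    (VW_law rho2 n n1 P B
     = \int[lebesgue_col R d \x lebesgue_col R d]_(vw in B)
         (pV vw.1 * pW vw.1 vw.2)%:E)%E
}.

Definition pos_orthant p : set 'cV[R]_p := [set t | forall i, 0 < t i 0].

Definition Q_mx p q : 'M[R]_(p + q, p) := col_mx 1%:M 0.

Definition F_weight p q (Sigma : 'M[R]_(p + q)) (rho2 : R) (r x : 'cV[R]_(p + q)) :
    R :=
  \int[lebesgue_col R p]_(t in @pos_orthant p)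
    expR (- (2 * rho2)^-1 * quad_form (invmx Sigma) (Q_mx p q *m t - x + r)).

(* Extended-real: finiteness is not automatic for an arbitrary version pW of the
   conditional density. *)
Definition Fbar_weight p q (pW : 'cV[R]_(p + q) -> 'cV[R]_(p + q) -> R)
    (r v : 'cV[R]_(p + q)) : \bar R :=
  (\int[lebesgue_col R p]_(t in @pos_orthant p)
     (pW v (Q_mx p q *m t - v + r)%R)%:E)%E.

(* P^(j)(z; b), with S = Sigma^{1/2}. *)
Definition pivot d (Sigma S : 'M[R]_d.+1) (F : 'cV[R]_d.+1 -> R) (j : 'I_d.+1)
    (b z : 'cV[R]_d.+1) : R :=
  let vu0 : 'cV[R]_(1 + d) := invmx (slice_mx Sigma j : 'M[R]_d.+1) *m (S *m z + b) in
  let v0 := usubmx vu0 0 0 in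
  let u0 := dsubmx vu0 in
  let g v := normal_pdf 0 1 ((v - b j 0) / Num.sqrt (Sigma j j))
             * F (slice_mx Sigma j *m col_mx v%:M u0) in
  (\int[lebesgue_measure]_(v in `]v0, +oo[) g v)
  / (\int[lebesgue_measure]_v g v).

(* E[Q w] / E[w], the expectation of Q reweighted by w >= 0. *)
Definition weighted_mean dsp (T : measurableType dsp)
    (mu : {measure set T -> \bar R}) (w : T -> \bar R) (Q : T -> R) : R :=
  fine (\int[mu]_x ((Q x)%:E * w x))%E / fine (\int[mu]_x w x)%E.

Definition Z_stat d (S : 'M[R]_d) (b : 'cV[R]_d) n (s : n.-tuple 'cV[R]_d) :
    'cV[R]_d :=
  invmx S *m (V_stat s - b).

Definition C3_bounded (H : R -> R) : Prop :=
  [/\ forall k x, (k < 3)%N -> derivable (derive1n k H) x 1,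
      continuous (derive1n 3 H)
    & forall k, (k <= 3)%N -> exists M : R, forall x, `|derive1n k H x| <= M].

(* Supremum in [0, +oo] (hence 0 over the empty collection). *)
Definition sup_ge0 (T : Type) (C : set T) (f : T -> \bar R) : \bar R :=
  ereal_sup (0%E |` [set f x | x in C]).

End carving.

(* Main.v *)
Require Import Defs.
From mathcomp Require Import all_boot all_order all_algebra.
From mathcomp Require Import all_classical all_reals all_analysis.
From mathcomp Require Import measurable_realfun ring lra.
Import Order.TTheory GRing.Theory Num.Theory.
Import numFieldNormedType.Exports.
Local Open Scope classical_set_scope.
Local Open Scope ring_scope.

(** Only the passage from the mean reweighted by F to the mean reweighted by the
    exact weight has to be controlled; the passage from the former to the Gaussian
    mean is a hypothesis. For two nonnegative weights w and w', a function Q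
    bounded by M and a measure giving w finite mass, the two reweighted means differ by

      |E[Q w'] / E[w'] - E[Q w] / E[w]| <= 2 M E|w' - w| / E[w],

    one half of the bound coming from the numerators and one from the denominators
    ([weighted_mean_dist]). For Q the composition of H with the pivot, the right-hand
    side is a constant multiple of the ratio assumed to vanish uniformly, with a
    constant that depends on H alone. The bound holds for every n and every law, so
    it passes to suprema and then to the limit ([sup_ge0_cvg0]).

    The rest of the work justifies the integrals. Linearity of the integral requires
    Q to be measurable, hence the pivot, a quotient of parametric integrals, to be
    measurable ([measurable_pivot]); the same argument gives the measurability of
    the two weights. The mass E[w] must be finite: this holds because F is bounded
    ([F_weight_bounded]). Invertibility of Sigma makes its inverse coercive
    ([quad_form_inv_coercive]), so that F is an integral of a function dominated by
    a product Gaussian of fixed width. *)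

Set Implicit Arguments.
Unset Strict Implicit.
Unset Printing Implicit Defensive.

(** * Measurability of matrix-valued maps, weights and pivot *)

Section matrix_measurability.
Context d (T : measurableType d) (R : realType).

Lemma measurable_mulmx m n k (A : 'M[R]_(m, n)) (f : T -> 'M[R]_(n, k)) :
  measurable_fun setT f -> measurable_fun setT (fun x => A *m f x).
Proof.
move=> /measurable_fun_matrixP mf; apply/measurable_fun_matrixP => i j.
under eq_fun do rewrite mxE.
by apply: measurable_sum => l; apply: measurable_funM.
Qed.

Lemma measurable_addmx m n (f g : T -> 'M[R]_(m, n)) :
  measurable_fun setT f -> measurable_fun setT g ->
  measurable_fun setT (fun x => f x + g x).
Proof.
move=> /measurable_fun_matrixP mf /measurable_fun_matrixP mg.
apply/measurable_fun_matrixP => i j.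
under eq_fun do rewrite mxE.
exact: measurable_funD.
Qed.

Lemma measurable_oppmx m n (f : T -> 'M[R]_(m, n)) :
  measurable_fun setT f -> measurable_fun setT (fun x => - f x).
Proof.
move=> /measurable_fun_matrixP mf; apply/measurable_fun_matrixP => i j.
under eq_fun do rewrite mxE.
exact: measurableT_comp.
Qed.

Lemma measurable_quad_form n (M : 'M[R]_n) (f : T -> 'cV[R]_n) :
  measurable_fun setT f -> measurable_fun setT (fun x => quad_form M (f x)).
Proof.
move=> mf; have /measurable_fun_matrixP mf' := mf.
rewrite /quad_form; under eq_fun do rewrite -mulmxA mxE.
apply: measurable_sum => l; apply: measurable_funM => //.
  by under eq_fun do rewrite mxE; exact: mf'.
have /measurable_fun_matrixP := measurable_mulmx M mf.
exact.
Qed.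

Lemma measurable_col_mx m1 m2 n (f : T -> 'M[R]_(m1, n)) (g : T -> 'M[R]_(m2, n)) :
  measurable_fun setT f -> measurable_fun setT g ->
  measurable_fun setT (fun x => col_mx (f x) (g x)).
Proof.
move=> /measurable_fun_matrixP mf /measurable_fun_matrixP mg.
apply/measurable_fun_matrixP => i j.
under eq_fun do rewrite mxE.
by case: (fintype.split i) => k; [exact: mf|exact: mg].
Qed.

Lemma measurable_usubmx m1 m2 n (f : T -> 'M[R]_(m1 + m2, n)) :
  measurable_fun setT f -> measurable_fun setT (fun x => usubmx (f x)).
Proof.
move=> /measurable_fun_matrixP mf; apply/measurable_fun_matrixP => i j.
by under eq_fun do rewrite mxE; exact: mf.
Qed.

Lemma measurable_dsubmx m1 m2 n (f : T -> 'M[R]_(m1 + m2, n)) :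
  measurable_fun setT f -> measurable_fun setT (fun x => dsubmx (f x)).
Proof.
move=> /measurable_fun_matrixP mf; apply/measurable_fun_matrixP => i j.
by under eq_fun do rewrite mxE; exact: mf.
Qed.

End matrix_measurability.

Lemma measurable_pos_orthant (R : realType) p : measurable (@pos_orthant R p).
Proof.
rewrite (_ : @pos_orthant R p = \bigcap_(i in [set: 'I_p])
    ((fun t : 'cV[R]_p => t i 0) @^-1` `]0, +oo[%classic)).
  apply: fin_bigcap_measurable => // i _.
  rewrite -[X in measurable X]setTI; exact: measurable_entry.
apply/seteqP; split=> t h i; first by move=> _; have := h i; rewrite /= in_itv/= andbT.
by have := h i I; rewrite /= in_itv/= andbT.
Qed.

(** Tonelli applied to the restriction of f to the set of pairs (x, y) with y in
    D x: a domain that moves with x, such as the half-line above v_0 in the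
    numerator of the pivot, needs no separate treatment. *)
Lemma measurable_integral_param d1 d2 (T1 : measurableType d1)
    (T2 : measurableType d2) (R : realType)
    (mu : {sigma_finite_measure set T2 -> \bar R}) (D : T1 -> set T2)
    (f : T1 -> T2 -> \bar R) :
  measurable [set xy : T1 * T2 | D xy.1 xy.2] ->
  (forall x y, 0 <= f x y)%E ->
  measurable_fun setT (fun xy : T1 * T2 => f xy.1 xy.2) ->
  measurable_fun setT (fun x => \int[mu]_(y in D x) f x y)%E.
Proof.
move=> mD f0 mf.
under eq_fun do rewrite integral_mkcond.
pose g := ((fun xy : T1 * T2 => f xy.1 xy.2) \_ [set xy : T1 * T2 | D xy.1 xy.2])%E.
rewrite (_ : (fun x => _) = fubini_F mu g).
  apply: measurable_fun_fubini_tonelli_F.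
    by apply/(measurable_restrictT _ mD); exact: measurable_funTS.
  by move=> [x y]; apply: erestrict_ge0.
apply/funext => x; apply: eq_integral => y _.
by rewrite /g /patch; congr (if _ then _ else _).
Qed.

Lemma measurable_cylinder d1 d2 (T1 : measurableType d1)
    (T2 : measurableType d2) (D : set T2) :
  measurable D -> measurable [set xy : T1 * T2 | D xy.2].
Proof.
by move=> mD; rewrite -[X in measurable X]setTI; exact: measurable_snd.
Qed.

(** The point at which both weights evaluate their density, as a function of the
    conditioning point and of the integration variable. *)
Lemma measurable_carving_arg (R : realType) p q (r : 'cV[R]_(p + q)) :
  measurable_fun setT
    (fun xt : 'cV[R]_(p + q) * 'cV[R]_p => Q_mx R p q *m xt.2 - xt.1 + r).
Proof.
apply: measurable_addmx => //; apply: measurable_addmx.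
  exact: measurable_mulmx.
exact: measurable_oppmx.
Qed.

Lemma measurable_F_weight (R : realType) p q (Sigma : 'M[R]_(p + q)) rho2 r :
  measurable_fun setT (F_weight Sigma rho2 r).
Proof.
apply: measurableT_comp => //.
apply: (@measurable_integral_param _ _ _ _ R (lebesgue_col R p) (fun=> @pos_orthant R p)).
- exact: (@measurable_cylinder _ _ _ _ (@pos_orthant R p) (@measurable_pos_orthant R p)).
- by move=> x t; rewrite lee_fin expR_ge0.
- apply/measurable_EFinP; apply: measurableT_comp => //; apply: measurable_funM => //.
  apply: measurable_quad_form; exact: measurable_carving_arg.
Qed.

Lemma F_weight_ge0 (R : realType) p q (Sigma : 'M[R]_(p + q)) rho2 r x :
  0 <= F_weight Sigma rho2 r x.
Proof. by apply: Rintegral_ge0 => t _; exact: expR_ge0. Qed.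

Lemma measurable_Fbar_weight (R : realType) p q
    (pW : 'cV[R]_(p + q) -> 'cV[R]_(p + q) -> R) r :
  measurable_fun setT (fun vw : 'cV[R]_(p + q) * 'cV[R]_(p + q) => pW vw.1 vw.2) ->
  (forall v w, 0 <= pW v w) ->
  measurable_fun setT (Fbar_weight pW r).
Proof.
move=> mpW pW0.
apply: (@measurable_integral_param _ _ _ _ R (lebesgue_col R p) (fun=> @pos_orthant R p)).
- exact: (@measurable_cylinder _ _ _ _ (@pos_orthant R p) (@measurable_pos_orthant R p)).
- by move=> x t; rewrite lee_fin.
- apply/measurable_EFinP.
  apply: (measurableT_comp mpW
    (g := fun xt : 'cV[R]_(p + q) * 'cV[R]_p => (xt.1, Q_mx R p q *m xt.2 - xt.1 + r))).
  apply/measurable_fun_pairP; split; first exact: measurable_fst.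
  exact: measurable_carving_arg.
Qed.

(** Both integrands are the same nonnegative function of z and v, measurable
    jointly in the two variables, so numerator and denominator are parametric
    integrals. *)
Lemma measurable_pivot (R : realType) d (Sigma S : 'M[R]_d.+1)
    (F : 'cV[R]_d.+1 -> R) (j : 'I_d.+1) (b : 'cV[R]_d.+1) :
  (forall x, 0 <= F x) -> measurable_fun setT F ->
  measurable_fun setT (pivot Sigma S F j b).
Proof.
move=> F0 mF; rewrite /pivot.
pose vu (z : 'cV[R]_d.+1) : 'cV[R]_(1 + d) :=
  invmx (slice_mx Sigma j : 'M[R]_d.+1) *m (S *m z + b).
have mvu : measurable_fun setT vu.
  by apply: measurable_mulmx; apply: measurable_addmx => //; apply: measurable_mulmx.
pose g z v := normal_pdf 0 1 ((v - b j 0) / Num.sqrt (Sigma j j))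
             * F (slice_mx Sigma j *m col_mx v%:M (dsubmx (vu z))).
have g0 z v : (0 <= (g z v)%:E)%E.
  by rewrite lee_fin mulr_ge0// normal_pdf_ge0.
have mg : measurable_fun setT
    (fun zv : 'cV[R]_d.+1 * measurableTypeR R => (g zv.1 zv.2)%:E).
  apply/measurable_EFinP; apply: measurable_funM.
    apply: measurableT_comp => //; first exact: measurable_normal_pdf.
    by apply: measurable_funM => //; apply: measurable_funB.
  apply: measurableT_comp => //; apply: measurable_mulmx; apply: measurable_col_mx.
    apply/measurable_fun_matrixP => i k.
    under eq_fun do rewrite mxE !ord1 eqxx mulr1n.
    exact: measurable_snd.
  apply: measurable_dsubmx.
  exact: measurableT_comp.
pose E := (fun z => \int[lebesgue_measure]_(v in `]usubmx (vu z) 0 0, +oo[) g z v).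
pose E' := (fun z => \int[lebesgue_measure]_v g z v).
rewrite (_ : (fun z => _) = (fun z => E z * (E' z)^-1))//.
have mv0 : measurable_fun setT (fun z => usubmx (vu z) 0 0).
  by have /measurable_fun_matrixP := measurable_usubmx mvu; exact.
have E'0 z : 0 <= E' z by apply: Rintegral_ge0 => v _; rewrite -lee_fin.
(* Measurability of the inverse is read off from that of the real power
   function, with which it agrees on nonnegative reals, including at 0. *)
under eq_fun do rewrite -(powR_inv1 (E'0 _)).
apply: measurable_funM.
- apply: measurableT_comp; first exact: fine_measurable.
  apply: (@measurable_integral_param _ _ _ _ R lebesgue_measure
    (fun z => `]usubmx (vu z) 0 0, +oo[%classic) (fun z v => (g z v)%:E)) => //.
  have -> : [set zv : 'cV[R]_d.+1 * measurableTypeR R |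
      `]usubmx (vu zv.1) 0 0, +oo[%classic zv.2]
      = (fun zv => usubmx (vu zv.1) 0 0 < zv.2) @^-1` [set true].
    by apply/seteqP; split=> zv /=; rewrite in_itv/= andbT.
  rewrite -[X in measurable X]setTI.
  apply: (measurable_fun_ltr _ _ measurableT) => //.
  exact: measurableT_comp mv0 _.
- apply: (measurableT_comp (f := fun e => e `^ (-1)) (measurable_powR _)).
  apply: measurableT_comp; first exact: fine_measurable.
  apply: (@measurable_integral_param _ _ _ _ R lebesgue_measure
    (fun=> setT) (fun z v => (g z v)%:E)) => //.
  rewrite (_ : [set _ | _] = setT); first exact: measurableT.
  exact/seteqP.
Qed.

(** * Boundedness of the Gaussian weight *)

Lemma product_power_setT d (T : measurableType d) (R : realType)
    (P : probability T R) n :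
  product_power P n setT = 1%E.
Proof.
have := @product_power_box d T R P n (fun=> setT) (fun=> measurableT).
rewrite (_ : [set t | _] = setT); last exact/seteqP.
by move=> ->; rewrite big1// => i _; exact: probability_setT.
Qed.

(** Induction on n: Tonelli splits off the first coordinate. *)
Lemma integral_product_power_prod d (T : measurableType d) (R : realType)
    (mu : {sigma_finite_measure set T -> \bar R}) n (f : 'I_n -> T -> R)
    (c : 'I_n -> R) :
  (forall i, measurable_fun setT (f i)) -> (forall i x, 0 <= f i x) ->
  (forall i, \int[mu]_x (f i x)%:E = (c i)%:E)%E ->
  (\int[product_power mu n]_t (\prod_(i < n) f i (tnth t i))%:E
   = (\prod_(i < n) c i)%:E)%E.
Proof.
elim: n f c => [|n IHn] f c mf f0 fc.
  rewrite /= integral_dirac//= ?diracT ?mul1e ?big_ord0//.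
  by apply/measurable_EFinP; apply: measurable_prod => i; case: i.
have mprod m (g : 'I_m -> T -> R) : (forall i, measurable_fun setT (g i)) ->
    measurable_fun setT (fun t : m.-tuple T => (\prod_(i < m) g i (tnth t i))%:E).
  move=> mg; apply/measurable_EFinP; apply: measurable_prod => i _.
  apply: measurableT_comp => //; exact: measurable_tnth.
rewrite /= ge0_integral_pushforward//=; last 3 first.
- exact: measurable_cons_pair.
- exact: mprod.
- by move=> t _; rewrite lee_fin prodr_ge0.
rewrite preimage_setT fubini_tonelli1//=; last 2 first.
- apply: (measurableT_comp (mprod _ _ mf)); exact: measurable_cons_pair.
- by move=> t; rewrite lee_fin prodr_ge0.
rewrite /fubini_F /=.
transitivity (\int[mu]_x ((f ord0 x)%:E * (\prod_(i < n) c (lift ord0 i))%:E))%E.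
  apply: eq_integral => x _.
  rewrite -(IHn (fun i => f (lift ord0 i)))// -ge0_integralZl//; last 3 first.
  - by apply: (mprod n (fun i => f (lift ord0 i))) => i.
  - by move=> t _; rewrite lee_fin prodr_ge0.
  - by rewrite lee_fin.
  apply: eq_integral => t _; rewrite big_ord_recl -EFinM /=.
  by congr (_ * _)%:E; apply: eq_bigr => i _; rewrite tnthS.
have c0 i : 0 <= c i.
  by rewrite -lee_fin -fc; apply: integral_ge0 => x _; rewrite lee_fin.
rewrite ge0_integralZr//; last 3 first.
- exact/measurable_EFinP.
- by move=> x _; rewrite lee_fin.
- by rewrite lee_fin prodr_ge0.
by rewrite fc -EFinM [in RHS]big_ord_recl.
Qed.

(** The density integrates to 1 and is the unnormalised Gaussian times its peak;
    an infinite integral is excluded since the peak is positive. *)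
Lemma integral_normal_fun (R : realType) (m s : R) : s != 0 ->
  (\int[lebesgue_measure]_x (normal_fun m s x)%:E = (normal_peak s)^-1%:E)%E.
Proof.
move=> s0.
have := integral_normal_pdf m s.
rewrite normal_pdfE//.
under eq_integral do rewrite EFinM.
rewrite ge0_integralZl//; last 3 first.
- by apply/measurable_EFinP; exact: measurable_normal_fun.
- by move=> x _; rewrite lee_fin normal_fun_ge0.
- by rewrite lee_fin normal_peak_ge0.
have I0 : (0 <= \int[lebesgue_measure]_x (normal_fun m s x)%:E)%E.
  by apply: integral_ge0 => x _; rewrite lee_fin normal_fun_ge0.
have p0 := normal_peak_gt0 s0.
case: (integral _ _ _) I0 => [r _ /eqP|_|//].
  rewrite -EFinM eqe => /eqP e; congr EFin.
  by apply: (mulfI (lt0r_neq0 p0)); rewrite e mulfV ?gt_eqF.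
by rewrite gt0_muley// lte_fin.
Qed.

Lemma integral_gaussian_col (R : realType) p (a : 'cV[R]_p) (s : R) : s != 0 ->
  (\int[lebesgue_col R p]_t (\prod_(i < p) normal_fun (a i 0%R) s (t i 0%R))%:E
   = ((normal_peak s)^-1 ^+ p)%:E)%E.
Proof.
move=> s0; rewrite /lebesgue_col /= ge0_integral_pushforward//=; last 3 first.
- exact: measurable_col_of_tuple.
- apply/measurable_EFinP; apply: measurable_prod => i _.
  apply: measurableT_comp; first exact: measurable_normal_fun.
  exact: measurable_entry.
- by move=> t _; rewrite lee_fin prodr_ge0// => i _; exact: normal_fun_ge0.
rewrite preimage_setT /comp.
under eq_integral => t _ do under eq_bigr => i _ do rewrite /col_of_tuple mxE.
rewrite -[X in _ ^+ X]card_ord -prodr_const.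
apply: (@integral_product_power_prod _ (measurableTypeR R) R lebesgue_measure p
  (fun i => normal_fun (a i 0) s) (fun=> (normal_peak s)^-1)).
- by move=> i; exact: measurable_normal_fun.
- by move=> i x; exact: normal_fun_ge0.
- by move=> i; exact: integral_normal_fun.
Qed.

(** Coercivity of the quadratic form of the inverse covariance. If y = S x, the
    form is the squared norm of x, and every entry of y is at most |x| times the
    sum of the absolute entries of S. This elementary constant K replaces the
    largest eigenvalue of Sigma. *)
Lemma quad_form_inv_coercive (R : realType) d (Sigma S : 'M[R]_d) :
  Sigma \in unitmx -> is_sqrt_mx Sigma S ->
  exists2 K : R, 0 < K &
    forall y : 'cV[R]_d, 0 <= quad_form (invmx Sigma) y /\
      forall i, (y i 0) ^+ 2 <= K * quad_form (invmx Sigma) y.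
Proof.
move=> uSigma [[ST _] SS].
have uS : S \in unitmx by move: uSigma; rewrite -SS unitmx_mul => /andP[].
(* The summand 1 keeps N positive in dimension 0. *)
pose N := 1 + \sum_i \sum_k `|S i k|.
have N1 : 1 <= N by rewrite lerDl sumr_ge0// => i _; rewrite sumr_ge0.
exists (N ^+ 2); first by rewrite exprn_gt0// (lt_le_trans ltr01).
move=> y.
have [x yE] : exists x, y = S *m x.
  by exists (invmx S *m y); rewrite mulmxA mulmxV// mul1mx.
have qE : quad_form (invmx Sigma) y = \sum_k (x k 0) ^+ 2.
  rewrite /quad_form yE trmx_mul ST -SS.
  have -> : x^T *m S *m invmx (S *m S) *m (S *m x) = x^T *m x.
    have -> : invmx (S *m S) = invmx S *m invmx S.
      apply: (row_free_inj (A := S *m S)); rewrite ?row_free_unit ?unitmx_mul ?uS//.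
      by rewrite mulVmx ?unitmx_mul ?uS// mulmxA mulmxKV// mulVmx.
    by rewrite !mulmxA mulmxK// mulmxKV.
  by rewrite mxE; apply: eq_bigr => k _; rewrite mxE expr2.
set q := quad_form _ _ in qE *.
have q0 : 0 <= q by rewrite qE sumr_ge0// => k _; rewrite sqr_ge0.
split=> // i.
have xq k : `|x k 0| <= Num.sqrt q.
  rewrite -sqrtr_sqr ler_wsqrtr// qE (bigD1 k)//= lerDl.
  by rewrite sumr_ge0// => l _; rewrite sqr_ge0.
have yq : `|y i 0| <= N * Num.sqrt q.
  rewrite yE mxE; apply: (le_trans (ler_norm_sum _ _ _)).
  apply: (@le_trans _ _ (\sum_k `|S i k| * Num.sqrt q)).
    by apply: ler_sum => k _; rewrite normrM ler_wpM2l.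
  rewrite -mulr_suml ler_wpM2r ?sqrtr_ge0//.
  have : \sum_k `|S i k| <= \sum_i \sum_k `|S i k|.
    rewrite [leRHS](bigD1 i)//= lerDl.
    by rewrite sumr_ge0// => l _; rewrite sumr_ge0.
  by move=> /le_trans; apply; rewrite lerDr.
have -> : N ^+ 2 * q = (N * Num.sqrt q) ^+ 2 by rewrite exprMn sqr_sqrtr.
by rewrite -real_normK ?num_real// lerXn2r// nnegrE mulr_ge0 ?sqrtr_ge0// (le_trans ler01 N1).
Qed.

(** By coercivity, the integrand is at most a product of one-dimensional Gaussians
    in the p integration variables, whose width s is the same for all x: only the
    centre a depends on x. The integral of this majorant over the whole space is
    therefore a bound independent of x. *)
Lemma F_weight_bounded (R : realType) p q (Sigma S : 'M[R]_(p + q)) rho2 r :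
  Sigma \in unitmx -> is_sqrt_mx Sigma S -> 0 < rho2 ->
  exists C : R, forall x, F_weight Sigma rho2 r x <= C.
Proof.
move=> uSigma sq rho0.
have [K K0 HK] := quad_form_inv_coercive uSigma sq.
(* Summing the p coordinate bounds costs a factor p, so a variance of at least
   p K rho2 is needed; p + 1 makes it positive also for p = 0. *)
pose s := Num.sqrt ((p%:R + 1) * K * rho2).
have s2 : s ^+ 2 = (p%:R + 1) * K * rho2.
  by rewrite sqr_sqrtr// !mulr_ge0 ?(ltW K0) ?(ltW rho0)// addr_ge0.
have s20 : 0 < s ^+ 2 by rewrite s2 !mulr_gt0// ltr_wpDl.
have s0 : s != 0 by move: s20; apply: contraTneq => ->; rewrite expr0n ltxx.
exists ((normal_peak s)^-1 ^+ p) => x.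
pose a := usubmx (x - r).
pose f t := expR (- (2 * rho2)^-1 * quad_form (invmx Sigma) (Q_mx R p q *m t - x + r)).
have fle t : f t <= \prod_(i < p) normal_fun (a i 0) s (t i 0).
  rewrite /normal_fun -expR_sum ler_expR.
  set y := Q_mx R p q *m t - x + r.
  have yi i : y (lshift q i) 0 = t i 0 - a i 0.
    rewrite /y /a /Q_mx mul_col_mx mul1mx mul0mx !mxE.
    rewrite (unsplitK (inl i)); ring.
  under eq_bigr do rewrite -yi.
  rewrite -mulr_suml sumrN mulNr mulNr lerN2.
  set qq := quad_form _ _.
  have sumle : \sum_(i < p) y (lshift q i) 0 ^+ 2 <= p%:R * (K * qq).
    rewrite mulr_natl -[p in leRHS]card_ord -sumr_const.
    by apply: ler_sum => i _; exact: (HK y).2.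
  have qq0 : 0 <= K * qq by rewrite mulr_ge0 ?(ltW K0)// (HK y).1.
  rewrite s2 -[_ *+ 2]mulr_natl ler_pdivrMr; last by rewrite mulr_gt0// -s2.
  rewrite (_ : _ * (2 * _) = (p%:R + 1) * (K * qq)); last first.
    by field; rewrite gt_eqF.
  by apply: (le_trans sumle); rewrite ler_wpM2r// lerDl.
have mf : measurable_fun setT f.
  apply: measurableT_comp => //; apply: measurable_funM => //.
  apply: measurable_quad_form; apply: measurable_addmx => //.
  by apply: measurable_addmx => //; exact: measurable_mulmx.
have mN : measurable_fun setT (fun t : 'cV[R]_p => \prod_(i < p) normal_fun (a i 0) s (t i 0)).
  apply: measurable_prod => i _.
  apply: measurableT_comp; first exact: measurable_normal_fun.
  exact: measurable_entry.
have Ile : (\int[lebesgue_col R p]_(t in @pos_orthant R p) (f t)%:E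
    <= \int[lebesgue_col R p]_t (\prod_(i < p) normal_fun (a i 0) s (t i 0))%:E)%E.
  apply: (@le_trans _ _ (\int[lebesgue_col R p]_t (f t)%:E)%E).
    apply: ge0_subset_integral => //.
    - exact: measurable_pos_orthant.
    - exact/measurable_EFinP.
    - by move=> t _; rewrite lee_fin expR_ge0.
  apply: ge0_le_integral => //.
  - by move=> t _; rewrite lee_fin expR_ge0.
  - exact/measurable_EFinP.
  - exact/measurable_EFinP.
  - by move=> t _; rewrite lee_fin fle.
move: Ile; rewrite (integral_gaussian_col a s0) => Ile.
rewrite -lee_fin /Rintegral fineK//.
rewrite ge0_fin_numE; first exact: (le_lt_trans Ile (ltry _)).
by apply: integral_ge0 => t _; rewrite lee_fin expR_ge0.
Qed.

(** * Changing the weight in a reweighted mean *)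

(** Here a, B are the total masses of two weights, qa, qB the integrals of a
    function bounded by M, and D the L1 distance of the weights. The total error
    is M D / a from the numerators and M D / a from the denominators, because
    qB / B is itself at most M. When B = 0 the quotient qB / B is 0 by convention
    and the bound survives, since then D >= a. *)
Lemma quotient_dist (R : realFieldType) (M a B D qa qB : R) :
  0 < a -> 0 <= B -> `|qa| <= M * a -> `|qB| <= M * B ->
  `|qB - qa| <= M * D -> `|B - a| <= D ->
  `|qB / B - qa / a| <= 2 * M * (D / a).
Proof.
move=> a0; rewrite le_eqVlt => /predU1P[<-|B0] qaM qBM qD BD.
  rewrite invr0 mulr0 sub0r normrN normrM normfV (gtr0_norm a0) mulrA.
  rewrite ler_pM2r ?invr_gt0//.
  have qB0 : qB = 0 by apply/normr0_eq0/eqP; rewrite eq_le normr_ge0 andbT; lra.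
  move: qD BD; rewrite qB0 !sub0r !normrN (gtr0_norm a0) => qD BD.
  have := normr_ge0 qa; lra.
have -> : qB / B - qa / a = ((qB - qa) + (qB / B) * (a - B)) / a.
  by field; rewrite !gt_eqF.
rewrite normrM normfV (gtr0_norm a0) mulrA ler_pM2r ?invr_gt0//.
have tM : `|qB / B| <= M by rewrite normrM normfV (gtr0_norm B0) ler_pdivrMr.
apply: (le_trans (ler_normD _ _)); rewrite normrM [`|a - B|]distrC.
have : `|qB / B| * `|B - a| <= M * D.
  exact: ler_pM.
lra.
Qed.

(** The bound holds in all degenerate cases. If the L1 distance is infinite, the
    right-hand side is infinite. If w has mass zero, the ratio on the right is
    infinite unless wb has mass zero as well, since the inverse of 0 is infinite
    and 0 times infinity is 0; in the latter case both means are 0. *)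
Lemma weighted_mean_dist dsp (T : measurableType dsp) (R : realType)
    (mu : {measure set T -> \bar R}) (w : T -> R) (wb : T -> \bar R)
    (Q : T -> R) (M : R) :
  0 < M -> (forall x, `|Q x| <= M) -> measurable_fun setT Q ->
  (forall x, 0 <= w x) -> mu.-integrable setT (EFin \o w) ->
  (forall x, (0 <= wb x)%E) -> measurable_fun setT wb ->
  (`|weighted_mean mu wb Q - weighted_mean mu (EFin \o w) Q|%:E
   <= (2 * M)%:E *
      (\int[mu]_x `|wb x - (w x)%:E| / \int[mu]_x (w x)%:E))%E.
Proof.
move=> M0 QM mQ w0 iw wb0 mwb.
have mw := measurable_int _ iw.
have mdiff : measurable_fun setT (fun x => wb x - (w x)%:E)%E.
  exact: emeasurable_funB.
pose D := (\int[mu]_x `|wb x - (w x)%:E|)%E.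
pose a := (\int[mu]_x (w x)%:E)%E.
have a0 : (0 <= a)%E by apply: integral_ge0 => x _; rewrite lee_fin.
have D0 : (0 <= D)%E by apply: integral_ge0.
have afin : a \is a fin_num by exact: integrable_fin_num.
have M20 : (0 < (2 * M)%:E)%E by rewrite lte_fin mulr_gt0.
rewrite -/D -/a.
have [Doo|Dfin] := eqVneq D +oo%E.
  rewrite Doo gt0_mulye ?gt0_muley ?leey// lt0e inve_ge0 a0 andbT inve_eq0.
  by apply: contraTneq afin => ->.
have idiff : mu.-integrable setT (fun x => wb x - (w x)%:E)%E.
  by apply/integrableP; split=> //; rewrite ltey.
have iwb : mu.-integrable setT wb.
  apply: (eq_integrable measurableT (fun x => wb x - (w x)%:E + (w x)%:E)%E).
    by move=> x _; rewrite subeK.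
  exact: (integrableD measurableT idiff iw).
have bdQ : [bounded Q x | x in setT].
  exists M; split; first exact: num_real.
  by move=> y My x _; apply: le_trans (QM x) (ltW My).
have iQ f : mu.-integrable setT f ->
    mu.-integrable setT (fun x => (Q x)%:E * f x)%E.
  by move=> intf; apply: integrableMr.
have bound f : mu.-integrable setT f ->
    (`|\int[mu]_x ((Q x)%:E * f x)| <= M%:E * \int[mu]_x `|f x|)%E.
  move=> intf; apply: (le_trans (le_abse_integral _ _ _)) => //.
    exact: measurable_int (iQ _ intf).
  have mf : measurable_fun setT (abse \o f).
    by apply: measurableT_comp => //; exact: measurable_int intf.
  rewrite -ge0_integralZl//; last by rewrite lee_fin ltW.
  apply: ge0_le_integral => //.
  - by apply: measurableT_comp => //; exact: measurable_int (iQ _ intf).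
  - exact: measurable_funeM.
  by move=> x _; rewrite abseM lee_wpmul2r// lee_fin.
pose B := (\int[mu]_x wb x)%E.
have B0 : (0 <= B)%E by apply: integral_ge0.
have Bfin : B \is a fin_num by exact: integrable_fin_num.
have Dfin' : D \is a fin_num by rewrite ge0_fin_numE// ltey.
pose qa := (\int[mu]_x ((Q x)%:E * (w x)%:E))%E.
pose qB := (\int[mu]_x ((Q x)%:E * wb x))%E.
have qafin : qa \is a fin_num by apply: integrable_fin_num => //; exact: iQ.
have qBfin : qB \is a fin_num by apply: integrable_fin_num => //; exact: iQ.
have qaM : (`|qa| <= M%:E * a)%E.
  have -> : a = (\int[mu]_x `|(w x)%:E|)%E.
    by apply: eq_integral => x _; rewrite gee0_abs// lee_fin.
  exact: bound.
have qBM : (`|qB| <= M%:E * B)%E.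
  have -> : B = (\int[mu]_x `|wb x|)%E.
    by apply: eq_integral => x _; rewrite gee0_abs.
  exact: bound.
have BD : (`|B - a| <= D)%E.
  rewrite /B /a -integralB//; exact: le_abse_integral.
have qD : (`|qB - qa| <= M%:E * D)%E.
  rewrite /qB /qa -(integralB _ (iQ _ iwb) (iQ _ iw))//.
  under eq_integral do rewrite -muleBr ?fin_num_adde_defl//.
  exact: bound.
rewrite /weighted_mean -/a -/B -/qa -/qB.
move: a0 D0 B0 qaM qBM BD qD.
rewrite -(fineK afin) -(fineK Dfin') -(fineK Bfin) -(fineK qafin) -(fineK qBfin).
rewrite -!EFinB -!EFinM !lee_fin => a0 D0 B0 qaM qBM BD qD /=.
have [a00|anz] := eqVneq (fine a) 0; last first.
  rewrite inver (negbTE anz) -!EFinM lee_fin; apply: quotient_dist => //.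
  by rewrite lt_neqAle eq_sym anz.
rewrite a00 inve0 invr0 mulr0 subr0.
have [D00|Dnz] := eqVneq (fine D) 0; last first.
  by rewrite gt0_muley ?gt0_muley ?leey// lte_fin lt_neqAle eq_sym Dnz.
have B00 : fine B = 0.
  by apply/eqP; rewrite -normr_le0; move: BD; rewrite a00 D00 subr0.
by rewrite B00 D00 invr0 mulr0 normr0 mul0e mule0.
Qed.

(** * Suprema over the collections, and the theorem *)

Lemma sup_ge0_cvg0 (R : realType) (T : Type) (C : nat -> set T)
    (f g h : nat -> T -> \bar R) (K : R) :
  0 <= K -> (forall n x, C n x -> (f n x <= g n x + K%:E * h n x)%E) ->
  sup_ge0 (C n) (g n) @[n --> \oo] --> 0%E ->
  sup_ge0 (C n) (h n) @[n --> \oo] --> 0%E ->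
  sup_ge0 (C n) (f n) @[n --> \oo] --> 0%E.
Proof.
move=> K0 fgh g0 h0.
have sup0 n (k : nat -> T -> \bar R) : (0 <= sup_ge0 (C n) (k n))%E.
  by apply: ereal_sup_ubound; left.
have sup_ub n (k : nat -> T -> \bar R) x : C n x -> (k n x <= sup_ge0 (C n) (k n))%E.
  by move=> Cx; apply: ereal_sup_ubound; right; exists x.
apply: (@squeeze_cvge _ _ _ _ (fun=> 0%E) _
  (fun n => sup_ge0 (C n) (g n) + K%:E * sup_ge0 (C n) (h n))%E).
- apply: nearW => n; rewrite sup0/=.
  apply: ge_ereal_sup => _ [->|[x Cx <-]].
    by rewrite adde_ge0 ?mule_ge0// ?lee_fin// sup0.
  apply: (le_trans (fgh _ _ Cx)); rewrite leeD ?sup_ub//.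
  by rewrite lee_wpmul2l ?lee_fin// sup_ub.
- exact: cvg_cst.
- rewrite -[X in _ --> X]adde0 -[X in _ --> (_ + X)%E](mule0 K%:E).
  apply: cvgeD => //.
  exact: cvgeZl.
Qed.

Lemma C3_bounded_measurable (R : realType) (H : R -> R) :
  C3_bounded H -> measurable_fun setT H.
Proof.
move=> [dH _ _]; apply: continuous_measurable_fun. move=> x.
apply/differentiable_continuous/derivable1_diffP.
exact: (dH 0%N).
Qed.

Lemma C3_bounded_bound (R : realType) (H : R -> R) :
  C3_bounded H -> exists2 M : R, 0 < M & forall x, `|H x| <= M.
Proof.
move=> [_ _ /(_ 0%N isT)[M HM]]; exists (`|M| + 1).
  by rewrite ltr_wpDl.
move=> x; apply: (le_trans (HM x)); apply: (le_trans (ler_norm _)).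
by rewrite lerDl.
Qed.

Lemma measurable_Z_stat (R : realType) d (S : 'M[R]_d) b n :
  measurable_fun setT (@Z_stat R d S b n).
Proof.
apply: measurable_mulmx; apply: measurable_addmx => //.
apply/measurable_fun_matrixP => i k; rewrite /V_stat.
under eq_fun do rewrite mxE summxE.
apply: measurable_funM => //; apply: measurable_sum => l.
apply: (measurableT_comp (measurable_entry i k)).
exact: measurable_tnth.
Qed.

Unset Implicit Arguments.
Set Strict Implicit.

Theorem proposition9 (R : realType) (p q : nat)
    (Sigma S : 'M[R]_(p.+1 + q)) (rho2 : R) (tau : 'cV[R]_(p.+1 + q))
    (Aobs : 'cV[R]_q) (j : 'I_p.+1) (n1 : nat -> nat)
    (C : nat -> set (probability 'cV[R]_(p.+1 + q) R))
    (pV : nat -> probability 'cV[R]_(p.+1 + q) R -> 'cV[R]_(p.+1 + q) -> R)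
    (pW : nat -> probability 'cV[R]_(p.+1 + q) R ->
          'cV[R]_(p.+1 + q) -> 'cV[R]_(p.+1 + q) -> R) :
  let d := (p.+1 + q)%N in
  let Lambda_sel := Num.sqrt (1 + rho2) *: tau in
  let r := col_mx (usubmx Lambda_sel) Aobs in
  let F := F_weight Sigma rho2 r in
  let Fbar n P := Fbar_weight (pW n P) r in
  let b n P := Num.sqrt n%:R *: mean_vec P in
  let Z n P := @Z_stat R d S (b n P) n in
  let piv n P : 'cV[R]_d -> R := pivot Sigma S F (lshift q j) (b n P) in
  let E_tilde n (P : probability 'cV[R]_d R) (Q : 'cV[R]_d -> R) :=
    weighted_mean (product_power P n)
      (fun s => (F (S *m Z n P s + b n P))%:E) (fun s => Q (Z n P s)) in
  let E_bar n (P : probability 'cV[R]_d R) (Q : 'cV[R]_d -> R) :=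
    weighted_mean (product_power P n)
      (fun s => Fbar n P (S *m Z n P s + b n P)) (fun s => Q (Z n P s)) in
  let E_normal n (P : probability 'cV[R]_d R) (Q : 'cV[R]_d -> R) :=
    weighted_mean (std_normal_col R d)
      (fun z => (F (S *m z + b n P))%:E) Q in
  Sigma \in unitmx ->
  sym_psd Sigma ->
  is_sqrt_mx Sigma S ->
  0 < rho2 ->
  (forall n P, C n P -> carving_law Sigma rho2 n (n1 n) P (pV n P) (pW n P)) ->
  (forall H : R -> R, C3_bounded H ->
    sup_ge0 (C n) (fun P =>
      `| E_tilde n P (H \o piv n P) - E_normal n P (H \o piv n P) |%:E)
      @[n --> \oo] --> 0%E) ->
  sup_ge0 (C n) (fun P =>
    (\int[product_power P n]_s
        `| Fbar n P (S *m Z n P s + b n P)%R - (F (S *m Z n P s + b n P)%R)%:E |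
     / \int[product_power P n]_s (F (S *m Z n P s + b n P)%R)%:E)%E)
    @[n --> \oo] --> 0%E ->
  forall H : R -> R, C3_bounded H ->
    sup_ge0 (C n) (fun P =>
      `| E_bar n P (H \o piv n P) - E_normal n P (H \o piv n P) |%:E)
      @[n --> \oo] --> 0%E.
Proof.
move=> d Lambda_sel r F Fbar b Z piv E_tilde E_bar E_normal.
move=> uSigma _ sqS rho0 law tilde_cvg ratio_cvg H HC3.
have [M M0 HM] := C3_bounded_bound HC3.
have mH := C3_bounded_measurable HC3.
have F0 x : 0 <= F x by exact: F_weight_ge0.
have mF : measurable_fun setT F by exact: measurable_F_weight.
have [K FK] := F_weight_bounded r uSigma sqS rho0.
apply: (sup_ge0_cvg0 (K := 2 * M) _ _ (tilde_cvg H HC3) ratio_cvg).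
  by rewrite mulr_ge0// ltW.
move=> n P CP; have CL := law n P CP.
have mZ : measurable_fun setT (Z n P) by exact: measurable_Z_stat.
have mX : measurable_fun setT (fun s => S *m Z n P s + b n P).
  by apply: measurable_addmx => //; exact: measurable_mulmx.
have bar_tilde := @weighted_mean_dist _ _ R (product_power P n)
  (fun s => F (S *m Z n P s + b n P))
  (fun s => Fbar n P (S *m Z n P s + b n P))
  (fun s => (H \o piv n P) (Z n P s)) M M0.
(* The mean reweighted by F is the intermediate point. *)
have triangle (x y z : R) : (`|x - z|%:E <= `|y - z|%:E + `|x - y|%:E)%E.
  by rewrite -EFinD lee_fin [leRHS]addrC ler_distD.
apply: le_trans (triangle _ (E_tilde n P (H \o piv n P)) _) _.
apply: leeD => //; apply: bar_tilde => //.
- by move=> s; exact: HM.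
- apply: (measurableT_comp _ mZ); apply: (measurableT_comp mH).
  exact: measurable_pivot.
(* A bounded weight has finite mass under the probability product_power P n. *)
- apply: (@le_integrable _ _ _ _ _ measurableT _ (cst K%:E)).
  + by apply/measurable_EFinP; exact: measurableT_comp mF mX.
  + by move=> s _ /=; rewrite lee_fin !ger0_norm ?FK// (le_trans (F0 0) (FK _)).
  + apply/integrableP; split=> //=; rewrite integral_cst//.
    by rewrite [X in (_ * X)%E](product_power_setT P n) mule1 ltry.
- by move=> s; apply: integral_ge0 => t _; rewrite lee_fin (pW_ge0 CL).
- apply: measurableT_comp mX.
  by apply: measurable_Fbar_weight; [exact: pW_measurable CL|exact: pW_ge0 CL].
Qed.
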